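(* Let $n\in\mathbb{D}$ be a squarefree integer with $n\equiv 1\pmod 4$. Let $q_1$ and $q_2$ be two positive binary quadratic forms of discriminant $-4n$. Then there exists a primitive two-dimensional sublattice $L\subset\mathbb{Z}^4$ with $\operatorname{disc}(Q_L)=-4n$, $[Q_L]=[q_1]$ and $[Q_{L^\perp}]=[q_2]$ if and only if the Legendre compositions of $q_1$ and $q_2$ belong to the genus class $\mathcal{G}_n$.
   Context: $\mathbb{D}=\{D\in\mathbb{N}:D\not\equiv 0,7,12,15\pmod{16}\}$. A two-dimensional sublattice $L\subset\mathbb{Z}^4$ is primitive if $(\mathbb{Q}L)\cap\mathbb{Z}^4=L$; $L^\perp=\{w\in\mathbb{Z}^4:\langle w,x\rangle=0\ \forall x\in L\}$. For a rank-2 sublattice $N=\langle u,v\rangle$ of $\mathbb{Z}^k$, $Q_N$ is the restriction of the sum-of-squares form to $N$, and $[Q_N]$ denotes the $\mathrm{GL}_2(\mathbb{Z})$-equivalence class of the binary form $(x,y)\mapsto Q_N(xu+yv)$; $\operatorname{disc}(Q_N)$ is $-4$ times the determinant of its Gram matrix (i.e. $b^2-4ac$ for $ax^2+bxy+cy^2$). A binary quadratic lattice $(M,q_M)$ is a Legendre composition of $(L,q_L)$ and $(L',q_{L'})$ if there is a surjective linear homomorphism $\mu:L\otimes L'\to M$ with $q_L(u)q_{L'}(v)=q_M(\mu(u\otimes v))$; forms $q$ are viewed as lattices $(\mathbb{Z}^2,q)$. $\mathcal{G}_n=\{[Q_3|_{v^\perp}]: v\in\mathbb{Z}^3,\ Q_3(v)=n\}$,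 where $Q_3(x,y,z)=x^2+y^2+z^2$ and $v^\perp\subset\mathbb{Z}^3$ is the orthogonal complement of $v$; by a theorem of Gauss, for such $n$ it is a single genus class of binary quadratic forms of discriminant $-4n$. *)

(* Defs.v *)
From mathcomp Require Import all_boot all_order all_algebra.
From mathcomp Require Import boolp classical_sets.
From mathcomp Require Import ring.

Set Implicit Arguments.
Unset Strict Implicit.
Unset Printing Implicit Defensive.

Import Order.TTheory GRing.Theory Num.Theory.

Local Open Scope classical_set_scope.
Local Open Scope ring_scope.

Definition DD : pred nat := [pred D | (D %% 16)%N \notin [:: 0; 7; 12; 15]%N].

Definition squarefree (n : nat) : Prop :=
  forall d : nat, (d ^ 2 %| n)%N -> d = 1%N.

(* The integral form a x^2 + b x y + c y^2; b may be odd. *)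
Record bqf : Type := BQF { qa : int; qb : int; qc : int }.

Definition bqf_eval (q : bqf) (x : 'rV[int]_2) : int :=
  let x0 := x 0 0 in let x1 := x 0 1 in
  qa q * x0 ^+ 2 + qb q * x0 * x1 + qc q * x1 ^+ 2.

Coercion bqf_eval : bqf >-> Funclass.

Definition disc (q : bqf) : int := qb q ^+ 2 - 4 * qa q * qc q.

Definition positive_form (q : bqf) : Prop :=
  forall x : 'rV[int]_2, x != 0 -> 0 < q x.

(* The GL_2(Z)-equivalence class [q]. *)
Definition bqf_class (q : bqf) : set bqf :=
  [set q' | exists2 g : 'M[int]_2, g \in unitmx & forall x, q' x = q (x *m g)].

Definition dotz (k : nat) (u v : 'rV[int]_k) : int := \sum_i u 0 i * v 0 i.

Definition sumsq (k : nat) (v : 'rV[int]_k) : int := dotz v v.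

(* The rows of B form a Z-basis of L. *)
Definition is_basis (k : nat) (L : set 'rV[int]_k) (B : 'M[int]_(2, k)) : Prop :=
  row_free (map_mx intr B : 'M[rat]_(2, k)) /\ L = range (fun x => x *m B).

Definition sublattice2 (k : nat) (L : set 'rV[int]_k) : Prop :=
  exists B, is_basis L B.

Definition Qspan (k : nat) (L : set 'rV[int]_k) : set 'rV[rat]_k :=
  [set x | exists m (c : 'rV[rat]_m) (A : 'M[int]_(m, k)),
     (forall i, L (row i A)) /\ x = c *m map_mx intr A].

Definition primitive_lattice (k : nat) (L : set 'rV[int]_k) : Prop :=
  [set x : 'rV[int]_k | Qspan L (map_mx intr x)] = L.

Definition orth (k : nat) (L : set 'rV[int]_k) : set 'rV[int]_k :=
  [set w | forall x, L x -> dotz w x = 0].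

Definition basis_form (k : nat) (B : 'M[int]_(2, k)) : bqf :=
  let u := row 0 B in let v := row 1 B in
  BQF (dotz u u) (2 * dotz u v) (dotz v v).

(* Q_L written in a chosen basis of L. The discriminant and the class do not
   depend on the choice: see [lattice_form_class] and [disc_class]. *)
Definition lattice_form (k : nat) (L : set 'rV[int]_k) : bqf :=
  basis_form (xget 0 [set B | is_basis L B]).

(* Z^2 (x) Z^2 is realized as 'M[int]_2, with u (x) v the outer product
   u^T *m v; every binary lattice M is taken, up to isometry, to be Z^2. *)
Definition legendre_composition (q1 q2 q : bqf) : Prop :=
  exists mu : {linear 'M[int]_2 -> 'rV[int]_2},
    (forall w, exists t, mu t = w) /\
    (forall u v : 'rV[int]_2, q1 u * q2 v = q (mu (u^T *m v))).

Definition GG (n : nat) : set (set bqf) :=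
  [set c | exists2 v : 'rV[int]_3,
     sumsq v = n%:Z & c = bqf_class (lattice_form (orth [set v]))].

Lemma basis_formE (k : nat) (B : 'M[int]_(2, k)) (x : 'rV[int]_2) :
  basis_form B x = sumsq (x *m B).
Proof.
rewrite /bqf_eval /sumsq /dotz /= !mulr_sumr !mulr_suml -!big_split /=.
apply: eq_bigr => i _; rewrite !mxE !big_ord_recl !big_ord0 /=.
have -> : lift ord0 ord0 = 1 :> 'I_2 by apply/val_inj.
have -> : ord0 = 0 :> 'I_2 by apply/val_inj.
move: (x 0 0) (x 0 1) (B 0 i) (B 1 i) => a b c d; ring.
Qed.

Lemma bqf_class_refl (q : bqf) : bqf_class q q.
Proof. by exists 1%:M; [exact: unitmx1 | move=> x; rewrite mulmx1]. Qed.

Lemma bqf_class_eq (q q' : bqf) : bqf_class q q' -> bqf_class q = bqf_class q'.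
Proof.
move=> [g gU qg]; apply/seteqP; split=> p [h hU ph].
  exists (h *m invmx g); first by rewrite unitmx_mul hU unitmx_inv.
  by move=> x; rewrite qg ph mulmxA mulmxKV.
exists (h *m g); first by rewrite unitmx_mul hU.
by move=> x; rewrite ph qg mulmxA.
Qed.

Lemma disc_class (q q' : bqf) : bqf_class q = bqf_class q' -> disc q = disc q'.
Proof.
move=> qq'; have [g gU E] : bqf_class q q' by rewrite qq'; exact: bqf_class_refl.
have g2 : (\det g) ^+ 2 = 1.
  rewrite unitmxE in gU.
  by have /orP[/eqP-> | /eqP->] : (\det g == 1) || (\det g == -1) by exact: gU.
have ev a b : q' (\row_i [:: a; b]`_i) =
    q (\row_i [:: a * g 0 0 + b * g 1 0; a * g 0 1 + b * g 1 1]`_i).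
  rewrite E; congr (bqf_eval q _); apply/rowP => i.
  rewrite !mxE !big_ord_recl big_ord0 !mxE /= addr0.
  by case: i => [] [|[]] //= p; congr (_ * g _ _ + _ * g _ _); apply/val_inj.
have := (ev 1 0, ev 0 1, ev 1 1); rewrite /bqf_eval !mxE /=.
move: g2; have det2 : \det g = g 0 0 * g 1 1 - g 0 1 * g 1 0.
  rewrite (expand_det_row _ 0) !big_ord_recl big_ord0 /cofactor !det_mx11 !mxE /=.
  have -> : lift ord0 ord0 = 1 :> 'I_2 by apply/val_inj.
  have -> : lift 1 0 = 0 :> 'I_2 by apply/val_inj.
  by rewrite /bump /= addn0 expr0 expr1 mul1r mulN1r mulrN addr0.
rewrite det2 /disc; case: q' {qq' E ev} => a b c /=.
move: (g 0 0) (g 0 1) (g 1 0) (g 1 1) (qa q) (qb q) (qc q).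
move=> r s t u x y z g2 [[Ha Hc] Hb].
have {}Ha : a = x * r ^+ 2 + y * r * s + z * s ^+ 2.
  by transitivity (a * 1 ^+ 2 + b * 1 * 0 + c * 0 ^+ 2); [ring | rewrite Ha; ring].
have {}Hc : c = x * t ^+ 2 + y * t * u + z * u ^+ 2.
  by transitivity (a * 0 ^+ 2 + b * 0 * 1 + c * 1 ^+ 2); [ring | rewrite Hc; ring].
have {}Hb : b = 2 * x * r * t + y * (r * u + s * t) + 2 * z * s * u.
  transitivity (a * 1 ^+ 2 + b * 1 * 1 + c * 1 ^+ 2 - a - c); first by ring.
  by rewrite Hb Ha Hc; ring.
transitivity ((r * u - s * t) ^+ 2 * (y ^+ 2 - 4 * x * z)).
  by rewrite g2 mul1r.
by rewrite Ha Hb Hc; ring.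
Qed.

Lemma lattice_form_class (k : nat) (L : set 'rV[int]_k) (B : 'M[int]_(2, k)) :
  is_basis L B -> bqf_class (lattice_form L) = bqf_class (basis_form B).
Proof.
move=> LB; rewrite /lattice_form.
have : is_basis L (xget 0 [set B | is_basis L B]) by apply: xgetPex; exists B.
move: (xget _ _) => C LC; apply: bqf_class_eq.
have sub (B1 B2 : 'M[int]_(2, k)) : is_basis L B1 -> is_basis L B2 ->
    exists h : 'M[int]_2, B1 = h *m B2.
  move=> [_ L1] [_ L2].
  have H (i : 'I_2) : exists x : 'rV[int]_2, x *m B2 = row i B1.
    have : L (row i B1) by rewrite L1 rowE; exists (delta_mx 0 i).
    by rewrite L2 => -[x _ <-]; exists x.
  exists (\matrix_i sval (cid (H i))).
  by apply/row_matrixP => i; rewrite row_mul rowK (svalP (cid (H i))).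
have [g Bg] := sub _ _ LB LC; have [h Ch] := sub _ _ LC LB.
exists g; last by move=> x; rewrite !basis_formE Bg mulmxA.
case: LB => Bfree _; suff : g *m h = 1%:M by move=> /mulmx1_unit[].
have ratI : injective (fun A : 'M[int]_2 => map_mx intr A : 'M[rat]_2).
  by move=> A A' /matrixP AA'; apply/matrixP => i j;
     move: (AA' i j); rewrite !mxE => /intr_inj.
apply/ratI/(row_free_inj Bfree).
by rewrite -!map_mxM -mulmxA -Ch -Bg mul1mx.
Qed.

(* Main.v *)
(* The criterion on both sides is that -q1(x)q2(y) be a square modulo n.

   Necessity: if (u1, u2) is a basis of L with u2 in the radical of Q_L modulo n,
   w is orthogonal to L and <l, u2> = 1, then the Gram determinant of
   (l, u2, u1, w) is a square congruent to -Q(u1)Q(w) modulo n. In the same way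
   -Q(y) is a square modulo n if y is orthogonal to v in Z^3 and Q(v) = n.

   Sufficiency: the congruence is what is needed to glue q1 and q2 into a positive
   unimodular lattice of rank 4, or <n> and q into one of rank 3; by Hermite's
   bound such a lattice is Z^4, respectively Z^3.

   A Legendre composition q of q1 and q2 has discriminant -4n and satisfies
   -q(mu(x (x) y)) = -q1(x)q2(y), so the two sides have the same residues; its
   existence is Dirichlet's composition of concordant forms. *)

Require Import Defs.
From mathcomp Require Import all_boot all_order all_algebra.
From mathcomp Require Import boolp classical_sets.
From mathcomp Require Import zify ring.

Set Implicit Arguments.
Unset Strict Implicit.
Unset Printing Implicit Defensive.

Import Order.TTheory GRing.Theory Num.Theory.

Local Open Scope classical_set_scope.
Local Open Scope ring_scope.

(** * Positive definite unimodular lattices of rank at most four *)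

Definition quad k (G : 'M[int]_k) (x : 'rV[int]_k) : int := (x *m G *m x^T) 0 0.

Definition posdef k (G : 'M[int]_k) : Prop :=
  forall x : 'rV[int]_k, x != 0 -> 0 < quad G x.

Lemma quadZ k (G : 'M[int]_k) c x : quad G (c *: x) = c ^+ 2 * quad G x.
Proof. by rewrite /quad linearZ /= -!scalemxAl -scalemxAr !mxE mulrA. Qed.

Lemma quad_conj k (G : 'M[int]_k) (R : 'M[int]_k) x :
  quad (R *m G *m R^T) x = quad G (x *m R).
Proof. by rewrite /quad trmx_mul !mulmxA. Qed.

Lemma mulmx_unit_neq0 k (R : 'M[int]_k) (x : 'rV[int]_k) :
  R \in unitmx -> x != 0 -> x *m R != 0.
Proof.
move=> RU; apply: contra_neq => xR0.
by rewrite -[x](mulmxK RU) xR0 mul0mx.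
Qed.

Lemma posdef_conj k (G : 'M[int]_k) (R : 'M[int]_k) :
  R \in unitmx -> posdef G -> posdef (R *m G *m R^T).
Proof. by move=> RU Gp x x0; rewrite quad_conj; exact/Gp/mulmx_unit_neq0. Qed.

Lemma det_int_sqr k (R : 'M[int]_k) : R \in unitmx -> \det R ^+ 2 = 1.
Proof.
rewrite unitmxE => gU.
by have /orP[/eqP-> | /eqP->] : (\det R == 1) || (\det R == -1) by exact: gU.
Qed.

(** The Smith normal form of a single row has at most one nonzero entry, so the row is a multiple of
    the first row of the right unimodular factor. *)
Lemma row_unimodular k (x : 'rV[int]_k.+1) :
  exists c, exists2 R : 'M[int]_k.+1, R \in unitmx & x = c *: row 0 R.
Proof.
have [L _ [R RU [d _ ->]]] := int_Smith_normal_form x.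
exists (L 0 0 * d`_0); exists R => //.
apply/rowP => j; rewrite -mulmxA mxE big_ord1 mxE big_ord_recl big1 => [|i _].
  by rewrite !mxE /= mulr1n addr0 mulrA.
by rewrite !mxE /= mulr0n mul0r.
Qed.

(** A shortest nonzero vector is [c] times a row of a unimodular matrix; since [1 <= c ^+ 2], that
    row is no longer, so a basis can start with a shortest vector. *)
Lemma min_vector k (G : 'M[int]_k.+1) : posdef G ->
  exists2 R : 'M[int]_k.+1, R \in unitmx &
    forall y, y != 0 -> quad G (row 0 R) <= quad G y.
Proof.
move=> Gp; pose P m := `[< exists2 x : 'rV_k.+1, x != 0 & quad G x = m%:Z >].
have toP x : x != 0 -> P `|quad G x|%N.
  by move=> x0; apply/asboolP; exists x; rewrite // gez0_abs // ltW // Gp.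
have exP : exists m, P m.
  exists `|quad G (delta_mx ord0 (ord0 : 'I_k.+1))|%N; apply: toP.
  by apply/eqP => /rowP/(_ (0 : 'I_k.+1))/eqP; rewrite !mxE.
case: (ex_minnP exP) => m /asboolP[x x0 qx] mmin.
have {}mmin y : y != 0 -> m%:Z <= quad G y.
  by move=> y0; have := mmin _ (toP _ y0); have := Gp _ y0; lia.
have [c [R RU xE]] := row_unimodular x; exists R => // y y0.
have r0 : row 0 R != 0 by apply: contra_neq x0; rewrite xE => ->; rewrite scaler0.
have c0 : c != 0 by apply: contra_neq x0; rewrite xE => ->; rewrite scale0r.
apply: le_trans (mmin _ y0); rewrite -qx xE quadZ ler_peMl ?(ltW (Gp _ r0)) //.
have : 0 < c ^+ 2 by rewrite exprn_even_gt0.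
lia.
Qed.

Lemma nearest_multiple (m z : int) : 0 < m -> exists t, 4 * (m * t + z) ^+ 2 <= m ^+ 2.
Proof.
(* Up to sign, the floor of [z / m + 1 / 2], an integer nearest to [z / m]. *)
move=> m0; exists (- ((2 * z + m) %/ (2 * m))%Z).
have := divz_eq (2 * z + m) (2 * m).
have := modz_ge0 (2 * z + m) (_ : 2 * m != 0).
have := ltz_mod (2 * z + m) (_ : 2 * m != 0).
move: (_ %/ _)%Z (_ %% _)%Z => q r /(_ ltac:(lia)) r1 /(_ ltac:(lia)) r2 E.
have -> : 4 * (m * - q + z) ^+ 2 = (r - m) ^+ 2.
  have -> : r = 2 * z + m - q * (2 * m) by rewrite E; ring.
  ring.
nia.
Qed.

Section SplitFirst.

Variables (k : nat) (G : 'M[int]_(1 + k)).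
Hypothesis Gs : G^T = G.

Let m := G 0 0.
Let r : 'rV[int]_k := ursubmx G.

(* [m] times the Schur complement of the corner entry [m] of [G]. *)
Definition schur : 'M[int]_k := m *: drsubmx G - r^T *m r.

Lemma split_first : G = block_mx m%:M r r^T (drsubmx G).
Proof.
rewrite -{1}[G]submxK; congr block_mx; last by rewrite /r trmx_ursub Gs.
by rewrite [ulsubmx G]mx11_scalar; congr (_%:M); rewrite !mxE; congr (G _ _); apply/val_inj.
Qed.

Lemma schur_sym : schur^T = schur.
Proof.
by rewrite /schur linearB /= linearZ /= trmx_mul trmxK trmx_drsub Gs.
Qed.

(** Completing the square in the first coordinate; the factor [m] keeps everything integral. *)
Lemma quad_split t (y : 'rV[int]_k) :
  m * quad G (row_mx t%:M y) = (m * t + (y *m r^T) 0 0) ^+ 2 + quad schur y.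
Proof.
have [s yr] : exists s, y *m r^T = s%:M by eexists; exact: mx11_scalar.
have ry : r *m y^T = s%:M by rewrite -[LHS]trmxK trmx_mul trmxK yr tr_scalar_mx.
rewrite /quad [in LHS]split_first mul_row_block tr_row_mx mul_row_col tr_scalar_mx.
rewrite /schur mulmxBr mulmxBl -scalemxAr -scalemxAl mulmxA -(mulmxA _ r) ry yr.
rewrite !mulmxDl -(mulmxA _ r) ry -!scalar_mxM.
move: (y *m _ *m _) => p; rewrite [p]mx11_scalar; move: (p 0 0) => {}p.
rewrite !mxE !eqxx !mulr1n; ring.
Qed.

(** Clearing the first column below the corner multiplies [G] by a block triangular matrix of
    determinant [m ^+ k]. *)
Lemma det_schur : m * \det schur = m ^+ k * \det G.
Proof.
have E : block_mx 1%:M 0 (- r^T) m%:M *m G = block_mx m%:M r 0 schur.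
  rewrite [in LHS]split_first mulmx_block !mul1mx !mul0mx !addr0.
  rewrite !mul_scalar_mx mulNmx mul_mx_scalar addNr; congr block_mx.
  by rewrite /schur mulNmx addrC.
have := congr1 (fun A => \det A) E.
by rewrite det_mulmx det_lblock det_ublock !det_scalar expr1n mul1r expr1 => ->.
Qed.

End SplitFirst.

Lemma quad_delta k (G : 'M[int]_k.+1) : quad G (delta_mx 0 0) = G 0 0.
Proof. by rewrite /quad -rowE trmx_delta -colE !mxE. Qed.

Lemma delta_row_neq0 k : delta_mx 0 0 != 0 :> 'rV[int]_k.+1.
Proof. by apply/eqP => /rowP/(_ ord0)/eqP; rewrite !mxE. Qed.

Lemma posdef_diag k (G : 'M[int]_k.+1) : posdef G -> 0 < G 0 0.
Proof. by move=> Gp; rewrite -quad_delta; exact/Gp/delta_row_neq0. Qed.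

Lemma quad_row k (G R : 'M[int]_k.+1) : (R *m G *m R^T) 0 0 = quad G (row 0 R).
Proof. by rewrite rowE -quad_conj quad_delta. Qed.

Lemma schur_posdef k (G : 'M[int]_(1 + k)) :
  G^T = G -> posdef G -> 0 < G 0 0 -> posdef (schur G).
Proof.
move=> Gs Gp m0 y y0.
(* For the vector [m y] the first coordinate [- y r^T] is integral and cancels the square, leaving
   only the Schur part. *)
have := quad_split Gs (- (y *m (ursubmx G)^T) 0 0) (G 0 0 *: y).
have -> : (G 0 0 *: y *m (ursubmx G)^T) 0 0 = G 0 0 * (y *m (ursubmx G)^T) 0 0.
  by rewrite -scalemxAl [LHS]mxE.
rewrite quadZ mulrN addNr expr0n add0r => E.
have : 0 < G 0 0 ^+ 2 * quad (schur G) y.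
  rewrite -E mulr_gt0 // Gp // row_mx_eq0 negb_and orbC scalemx_eq0.
  by rewrite negb_or y0 (gt_eqF m0).
by rewrite pmulr_rgt0 // exprn_gt0.
Qed.

(** Choosing [t] with [m t + y r^T] at most [m / 2] in absolute value, minimality of [m] gives
    [m ^ 2 <= m ^ 2 / 4 + quad schur y]. *)
Lemma schur_ge k (G : 'M[int]_(1 + k)) (y : 'rV[int]_k) :
  G^T = G -> posdef G -> (forall x, x != 0 -> G 0 0 <= quad G x) -> 0 < G 0 0 ->
  y != 0 -> 3 * G 0 0 ^+ 2 <= 4 * quad (schur G) y.
Proof.
move=> Gs Gp Gmin m0 y0.
have [t tP] := nearest_multiple ((y *m (ursubmx G)^T) 0 0) m0.
have E := quad_split Gs t y.
have z0 : row_mx t%:M y != 0 by rewrite row_mx_eq0 negb_and y0 orbT.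
have := Gmin _ z0; move: E tP m0; rewrite /=.
move: (quad G _) (quad (schur G) y) (G 0 0) (_ 0 0 : int) => u w m s; nia.
Qed.

(* Hermite's bound [m ^ k <= (4 / 3) ^ 'C(k, 2) * det G]: the multiple [schur G] of the
   projected form has values at least [3 m ^ 2 / 4]. *)
Lemma hermite k (G : 'M[int]_k.+1) : G^T = G -> posdef G ->
  exists2 x : 'rV[int]_k.+1, x != 0 &
    quad G x ^+ k.+1 * 3 ^+ 'C(k.+1, 2) <= 4 ^+ 'C(k.+1, 2) * \det G.
Proof.
elim: k G => [|k IH] G Gs Gp.
  exists (delta_mx 0 0); first exact: delta_row_neq0.
  by rewrite quad_delta bin_small // mulr1 mul1r det_mx11.
have [R RU Rmin] := min_vector Gp.
exists (row 0 R); first by rewrite rowE; exact/mulmx_unit_neq0/delta_row_neq0.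
have dG : \det (R *m G *m R^T) = \det G.
  by rewrite !det_mulmx det_tr mulrAC -expr2 det_int_sqr // mul1r.
have Gp' := posdef_conj RU Gp; have m0 := posdef_diag Gp'.
have Gs' : (R *m G *m R^T)^T = R *m G *m R^T by rewrite !trmx_mul trmxK Gs mulmxA.
have Gmin y : y != 0 -> (R *m G *m R^T) 0 0 <= quad (R *m G *m R^T) y.
  by move=> y0; rewrite quad_row quad_conj; apply/Rmin/mulmx_unit_neq0.
rewrite -dG -quad_row.
move: (R *m G *m R^T) Gp' Gs' m0 Gmin => H Hp Hs m0 Hmin.
have [y y0 yS] := IH _ (schur_sym Hs) (schur_posdef Hs Hp m0).
have mS := schur_ge Hs Hp Hmin m0 y0.
have dS := det_schur Hs.
rewrite binS bin1 !(exprD _ 'C(k.+1, 2)).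
have qS := schur_posdef Hs Hp m0 y0.
move: (quad _ y) (\det (schur H)) (\det H) (H 0 0) mS dS yS qS m0 => w d' d m mS dS yS w0 m0.
(* The factor [m ^+ k.+1] lets [dS] trade the determinant of [H] for that of its Schur form, to
   which [yS] applies. *)
rewrite -(ler_pM2l (exprn_gt0 k.+1 m0)).
have -> : m ^+ k.+1 * (4 ^+ 'C(k.+1, 2) * 4 ^+ k.+1 * d) =
   m * (4 ^+ k.+1 * (4 ^+ 'C(k.+1, 2) * d')).
  transitivity (4 ^+ k.+1 * 4 ^+ 'C(k.+1, 2) * (m * d')); last by ring.
  by rewrite dS; ring.
have -> : m ^+ k.+1 * (m ^+ k.+2 * (3 ^+ 'C(k.+1, 2) * 3 ^+ k.+1)) =
   m * ((3 * m ^+ 2) ^+ k.+1 * 3 ^+ 'C(k.+1, 2)).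
  rewrite exprMn -exprM [m ^+ k.+2]exprS mul2n -addnn exprD; ring.
rewrite ler_pM2l //.
apply: (le_trans (y := (4 * w) ^+ k.+1 * 3 ^+ 'C(k.+1, 2))).
  by rewrite ler_wpM2r ?exprn_ge0 // lerXn2r // nnegrE; nia.
by rewrite exprMn -mulrA ler_wpM2l // exprn_ge0.
Qed.

(** Hermite's bound forces the minimum to be 1. A vector of norm 1 splits off, the Schur form on the
    complement is again unimodular, and induction on the rank applies. *)
Lemma unimodular_sum_of_squares k (G : 'M[int]_k) : (k <= 4)%N ->
  G^T = G -> posdef G -> G \in unitmx -> exists U : 'M[int]_k, U *m U^T = G.
Proof.
elim: k G => [|k IH] G k4 Gs Gp GU; first by exists 0; apply/matrixP => -[].
have [R RU Rmin] := min_vector Gp; have [x x0 xG] := hermite Gs Gp.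
have Gp' := posdef_conj RU Gp; have m0 := posdef_diag Gp'.
have Gs' : (R *m G *m R^T)^T = R *m G *m R^T by rewrite !trmx_mul trmxK Gs mulmxA.
have m1 : (R *m G *m R^T) 0 0 = 1.
  have dG : \det G = 1.
    have := det_int_sqr GU; have : 0 < \det G; last by nia.
    have : 0 < 4 ^+ 'C(k.+1, 2) * \det G.
      by apply: lt_le_trans xG; rewrite mulr_gt0 // exprn_gt0 // Gp.
    by rewrite pmulr_rgt0 // exprn_gt0.
  have w1 : quad G (row 0 R) ^+ k.+1 * 3 ^+ 'C(k.+1, 2) <= 4 ^+ 'C(k.+1, 2).
    move: xG; rewrite dG mulr1; apply: le_trans.
    rewrite ler_wpM2r ?exprn_ge0 // lerXn2r ?nnegrE ?Rmin //.
      by rewrite -quad_row ltW.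
    exact/ltW/Gp.
  move: m0 w1; rewrite quad_row; move: (quad _ _) => m m0 w1.
  have := erefl (m <= 1); case: {2}(m <= 1) => m2; first lia.
  have {m2} m2 : 2 <= m by lia.
  (* A minimum of at least 2 contradicts Hermite's bound: in each rank r from 1 to 4,
     [2 ^ r * 3 ^ 'C(r, 2)] exceeds [4 ^ 'C(r, 2)]. *)
  have : 2 ^+ k.+1 * 3 ^+ 'C(k.+1, 2) <= 4 ^+ 'C(k.+1, 2) :> int.
    by apply: le_trans w1; rewrite ler_wpM2r ?exprn_ge0 // lerXn2r ?nnegrE //; lia.
  by clear -k4; case: k k4 => [|[|[|[|]]]].
have SU : schur (R *m G *m R^T) \in unitmx.
  have := det_schur Gs'; rewrite m1 expr1n !mul1r unitmxE => ->.
  by rewrite -unitmxE !unitmx_mul unitmx_tr RU GU.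
have [|V VE] := IH _ (ltnW k4) (schur_sym Gs') _ SU.
  by apply: schur_posdef; rewrite ?m1.
have := split_first Gs'; move: VE.
rewrite /schur m1 scale1r; move: (ursubmx _) (drsubmx _) => r D VD.
move=> /(congr1 (fun A => invmx R *m A *m (invmx R)^T)).
rewrite !mulmxA mulVmx // mul1mx -mulmxA -trmx_mul mulVmx // trmx1 mulmx1 => ->.
(* One step of a Cholesky factorization: [V] factors the Schur form [D - r^T *m r]. *)
pose B : 'M[int]_(1 + k) := block_mx 1%:M 0 r^T V.
have BT : B *m B^T = block_mx 1%:M r r^T D.
  rewrite tr_block_mx trmx1 trmxK trmx0 mulmx_block !mul1mx !mulmx1 !mul0mx.
  by rewrite !mulmx0 !addr0 VD subrKC.
by exists (invmx R *m B); rewrite trmx_mul mulmxA -(mulmxA _ B) BT.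
Qed.

(** * Binary forms and Legendre compositions *)

Definition rv2 (x y : int) : 'rV[int]_2 := \row_i [:: x; y]`_i.

Definition mx2 (a b c d : int) : 'M[int]_2 :=
  \matrix_(i, j) (if i == 0 then rv2 a b else rv2 c d) 0 j.

Lemma rv2_0 x y : rv2 x y 0 0 = x. Proof. by rewrite mxE. Qed.
Lemma rv2_1 x y : rv2 x y 0 1 = y. Proof. by rewrite mxE. Qed.

Lemma rv2E (x : 'rV[int]_2) : x = rv2 (x 0 0) (x 0 1).
Proof.
apply/rowP => i; rewrite mxE.
by case: i => [[|[|]]] //= p; congr (x _ _); apply/val_inj.
Qed.

Lemma mx2E (g : 'M[int]_2) : g = mx2 (g 0 0) (g 0 1) (g 1 0) (g 1 1).
Proof.
apply/matrixP => i j; rewrite !mxE.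
by case: i => [[|[|]]] //= ?; rewrite mxE;
  case: j => [[|[|]]] //= p; congr (g _ _); apply/val_inj.
Qed.

Lemma mul_rv2_mx2 x y a b c d :
  rv2 x y *m mx2 a b c d = rv2 (x * a + y * c) (x * b + y * d).
Proof.
apply/rowP => i; rewrite !mxE !big_ord_recl big_ord0 !mxE /= addr0.
by case: i => [[|[|]]] //= p; rewrite !mxE.
Qed.

Lemma det_mx2 a b c d : \det (mx2 a b c d) = a * d - b * c.
Proof.
rewrite (expand_det_row _ 0) !big_ord_recl big_ord0 /cofactor !det_mx11 !mxE /=.
rewrite ?mxE /= expr0 expr1; ring.
Qed.

Lemma bqf_rv2 q x y : bqf_eval q (rv2 x y) = qa q * x ^+ 2 + qb q * x * y + qc q * y ^+ 2.
Proof. by rewrite /bqf_eval rv2_0 rv2_1. Qed.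

Definition bqf_act (q : bqf) (g : 'M[int]_2) : bqf :=
  BQF (q (row 0 g))
      (2 * qa q * g 0 0 * g 1 0 + qb q * (g 0 0 * g 1 1 + g 0 1 * g 1 0)
        + 2 * qc q * g 0 1 * g 1 1)
      (q (row 1 g)).

Lemma bqf_actE q g x : bqf_act q g x = q (x *m g).
Proof.
rewrite [x]rv2E [g]mx2E mul_rv2_mx2 !bqf_rv2 /= /bqf_eval !mxE /= ?mxE /=; ring.
Qed.

Lemma disc_act q g : disc (bqf_act q g) = \det g ^+ 2 * disc q.
Proof. rewrite [g]mx2E det_mx2 /disc /= /bqf_eval !mxE /= ?mxE /=; ring. Qed.

Lemma bqf_ext (q q' : bqf) : (forall x, q x = q' x) -> q = q'.
Proof.
move=> E; have := (E (rv2 1 0), E (rv2 0 1), E (rv2 1 1)).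
by rewrite !bqf_rv2; case: q q' {E} => a b c [a' b' c'] /= [[? ?] ?]; congr BQF; lia.
Qed.

Lemma class_act q g : g \in unitmx -> bqf_class q (bqf_act q g).
Proof. by move=> gU; exists g => // x; rewrite bqf_actE. Qed.

Lemma disc_in_class q q' : bqf_class q q' -> disc q' = disc q.
Proof. by move/bqf_class_eq/disc_class. Qed.

Lemma class_trans q q' q'' : bqf_class q q' -> bqf_class q' q'' -> bqf_class q q''.
Proof. by move=> /bqf_class_eq->. Qed.

Lemma class_sym q q' : bqf_class q q' -> bqf_class q' q.
Proof. by move/bqf_class_eq<-; exact: bqf_class_refl. Qed.

Lemma unitmx2 a b c d : a * d - b * c = 1 -> mx2 a b c d \in unitmx.
Proof. by move=> E; rewrite unitmxE det_mx2 E unitr1. Qed.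

Lemma class_shear a b c k :
  bqf_class (BQF a b c) (BQF a (b + 2 * a * k) (a * k ^+ 2 + b * k + c)).
Proof.
exists (mx2 1 0 k 1); first by apply: unitmx2; ring.
by move=> x; rewrite [x]rv2E mul_rv2_mx2 !bqf_rv2 /=; ring.
Qed.

Lemma disc_even (n : nat) q : disc q = - (4 * n%:Z) -> exists b, qb q = 2 * b.
Proof.
rewrite /disc => D; have := divz_eq (qb q) 2.
have := modz_ge0 (qb q) (_ : (2 : int) != 0) => /(_ isT).
have := ltz_mod (qb q) (_ : (2 : int) != 0) => /(_ isT).
move: (_ %/ _)%Z (_ %% _)%Z => b r r1 r2 E; exists b; rewrite E.
suff -> : r = 0 by lia.
move: D; rewrite E; have [->//|->] : r = 0 \/ r = 1 by lia.
lia.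
Qed.

Section FundamentalDiscriminant.

Variable n : nat.
Hypotheses (nsf : squarefree n) (n4 : (n = 1 %[mod 4])%N).

(** A common prime [p] gives [- n = b ^ 2 - a c p ^ 2] with [2 b] the middle coefficient. If
    [p = 2], then -1 is a square modulo 4; if [p] is odd, it divides [b], so [p ^ 2] divides [n]. *)
Lemma disc_primitive q p : disc q = - (4 * n%:Z) -> prime p ->
  ~ [/\ (p%:Z %| qa q)%Z, (p%:Z %| qb q)%Z & (p%:Z %| qc q)%Z].
Proof.
move=> D pp [/dvdzP[a aE] pb /dvdzP[c cE]].
have [b bE] := disc_even D.
have E : b ^+ 2 - a * c * p%:Z ^+ 2 = - n%:Z.
  by move: D; rewrite /disc bE aE cE; lia.
have [p2|p2] := eqVneq p 2%N.
  move: E n4; rewrite p2 => E n4'.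
  have := divn_eq n 4; rewrite n4' => nE.
  have [k [bk|bk]] : exists k, b = 2 * k \/ b = 2 * k + 1.
    exists (b %/ 2)%Z; lia.
    by move: E; rewrite bk; lia.
  by move: E; rewrite bk; lia.
have /dvdzP[b' b'E] : (p%:Z %| b)%Z.
  move: pb; rewrite bE Gauss_dvdzr // coprimezE /= prime_coprime //.
  by rewrite dvdn_prime2.
have : (p ^ 2 %| n)%N.
  have : (p%:Z ^+ 2 %| n%:Z)%Z.
    by apply/dvdzP; exists (a * c - b' ^+ 2); rewrite b'E in E; lia.
  by rewrite -[_ ^+ 2]/((p ^ 2)%N%:Z).
by move/nsf => p1; rewrite p1 in pp.
Qed.

End FundamentalDiscriminant.

(** * Values coprime to a modulus, and adapted representatives of a class *)

Lemma Euclid_dvdzM p (x y : int) : prime p ->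
  (p%:Z %| x * y)%Z = (p%:Z %| x)%Z || (p%:Z %| y)%Z.
Proof. by move=> pp; rewrite !dvdzE abszM Euclid_dvdM. Qed.

Lemma coprimez_primes (m : int) (N : nat) : (0 < N)%N ->
  (forall p, prime p -> (p %| N)%N -> ~~ (p%:Z %| m)%Z) -> coprimez m N%:Z.
Proof.
move=> N0 H; rewrite coprimezE /= /coprime; apply/negPn/negP => g1.
have g0 : (0 < gcdn `|m| N)%N by rewrite gcdn_gt0 N0 orbT.
have pp : prime (pdiv (gcdn `|m| N)) by apply: pdiv_prime; move: g0 g1; case: gcdn => [|[]].
have pg := pdiv_dvd (gcdn `|m| N).
case/negP: (H _ pp (dvdn_trans pg (dvdn_gcdr _ _))).
by rewrite dvdzE (dvdn_trans pg (dvdn_gcdl _ _)).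
Qed.

Lemma coprime_value q (N : nat) : (0 < N)%N ->
  (forall p, prime p ->
     ~ [/\ (p%:Z %| qa q)%Z, (p%:Z %| qb q)%Z & (p%:Z %| qc q)%Z]) ->
  exists x y, coprimez x y /\ coprimez (q (rv2 x y)) N%:Z.
Proof.
move=> N0 qprim.
(* [x] collects the primes of [N] dividing [qa q] but not [qc q], and [y] those not dividing [qa q].
   Modulo each prime of [N] exactly one of the three terms of the value survives. *)
pose P : nat_pred := [pred p : nat | (p%:Z %| qa q)%Z].
pose P1 : nat_pred := [pred p : nat | (p%:Z %| qa q)%Z && ~~ (p%:Z %| qc q)%Z].
have memp (pi : nat_pred) p : prime p -> (p %| N)%N ->
    (p%:Z %| (N`_pi)%:Z)%Z = (p \in pi).
  move=> pp pN; have := primes_part pi N => /(congr1 (fun s => p \in s)).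
  by rewrite mem_filter !mem_primes pp pN N0 part_gt0 /= andbT.
exists (N`_P1)%:Z, (N`_P^')%:Z; split.
  apply: (@pnat_coprime P); last exact: part_pnat.
  by apply: sub_in_pnat (part_pnat P1 N) => p _ /andP[].
apply: coprimez_primes => // p pp pN; rewrite bqf_rv2.
have := memp P1 _ pp pN; have := memp P^' _ pp pN; rewrite !inE.
move: (N`_P1)%:Z (N`_P^')%:Z => x y.
have := @qprim p pp; case pa: (p%:Z %| qa q)%Z; case pc: (p%:Z %| qc q)%Z => /= pb py px.
- rewrite rpredDr ?(dvdz_mulr _ pc) // rpredDl ?(dvdz_mulr _ pa) //.
  by rewrite !Euclid_dvdzM // px py !orbF; apply/negP => pb'; apply: pb.
- rewrite rpredDl; first by rewrite expr2 !Euclid_dvdzM // py pc.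
  by rewrite rpredD // !Euclid_dvdzM // px ?pa ?orbT.
- rewrite -addrA rpredDr; first by rewrite expr2 !Euclid_dvdzM // px pa.
  by rewrite rpredD // ?expr2 !Euclid_dvdzM // py ?orbT.
- rewrite -addrA rpredDr; first by rewrite expr2 !Euclid_dvdzM // px pa.
  by rewrite rpredD // ?expr2 !Euclid_dvdzM // py ?orbT.
Qed.

Lemma act_first_coprime q (N : nat) : (0 < N)%N ->
  (forall p, prime p ->
     ~ [/\ (p%:Z %| qa q)%Z, (p%:Z %| qb q)%Z & (p%:Z %| qc q)%Z]) ->
  exists2 q', bqf_class q q' & coprimez (qa q') N%:Z.
Proof.
move=> N0 qprim; have [x [y [xy xyN]]] := coprime_value N0 qprim.
have [[u v] /= uv] := coprimezP _ _ xy.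
exists (bqf_act q (mx2 x y (- v) u)).
  by apply/class_act/unitmx2; rewrite -uv; ring.
rewrite /= (_ : row 0 _ = rv2 x y) //.
by apply/rowP => i; rewrite !mxE.
Qed.

Lemma disc_BQF_half a b c (d : int) :
  disc (BQF a (2 * b) c) = - (4 * d) -> a * c = b ^+ 2 + d.
Proof. by rewrite /disc /=; lia. Qed.

(* The second basis vector spans the radical of the form modulo [n]. *)
Lemma normal_form (n : nat) (q : bqf) :
  squarefree n -> (n = 1 %[mod 4])%N -> disc q = - (4 * n%:Z) ->
  exists a b c : int, a * c = 1 + n%:Z * b ^+ 2 /\
    bqf_class q (BQF a (2 * (n%:Z * b)) (n%:Z * c)).
Proof.
move=> nsf n4 D.
have n0 : (0 < n)%N by case: n n4 {nsf D}.
have [q' qq' qn] := act_first_coprime n0 (fun p => disc_primitive nsf n4 D).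
have D' := disc_in_class qq'; rewrite D in D'.
have [b bE] := disc_even D'.
case: q' bE D' qq' qn => a b0 c /= -> D' qq' an.
have [[u v] /= uv] := coprimezP _ _ an.
(* [u] inverts [a] modulo [n], so this shear makes half the middle coefficient divisible by [n]; the
   discriminant then makes the last one divisible too. *)
have sh := class_shear a (2 * b) c (- b * u).
have Db := disc_in_class sh; rewrite D' in Db.
move: (class_trans qq' sh) Db.
have -> : 2 * b + 2 * a * (- b * u) = 2 * (n%:Z * (b * v)).
  transitivity (2 * b * (u * a + v * n%:Z) - 2 * a * b * u); last by ring.
  by rewrite uv; ring.
move: (_ + c) (b * v) => c' b' cl /disc_BQF_half ac.
have /dvdzP[c'' cE] : (n%:Z %| c')%Z.
  rewrite -(Gauss_dvdzr _ (_ : coprimez n%:Z a)); last by rewrite coprimez_sym.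
  by rewrite ac rpredD // expr2 !dvdz_mulr.
exists a, b', c''; split; last by rewrite [n%:Z * c'']mulrC -cE.
have nz : n%:Z != 0 by lia.
apply: (mulfI nz); rewrite mulrDr mulr1.
transitivity (a * c'); first by rewrite cE; ring.
by rewrite ac; ring.
Qed.

(** Once the leading coefficients are coprime, shears move the half middle coefficients by multiples
    of [a1] and [a2], and the Chinese remainder theorem makes them equal. Then [a1 a2] divides
    [b ^ 2 + n]. *)
Lemma concordant_forms (n : nat) (q1 q2 : bqf) :
  squarefree n -> (n = 1 %[mod 4])%N ->
  disc q1 = - (4 * n%:Z) -> disc q2 = - (4 * n%:Z) ->
  exists a1 a2 b c : int, [/\ coprimez a1 a2,
    bqf_class q1 (BQF a1 (2 * b) (a2 * c)) & bqf_class q2 (BQF a2 (2 * b) (a1 * c))].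
Proof.
move=> nsf n4 D1 D2.
have n0 : (0 < n)%N by case: n n4 {nsf D1 D2}.
have a0 : (0 < `|qa q1|)%N.
  rewrite absz_gt0; apply/eqP => a0; move: D1; rewrite /disc a0.
  have := sqr_ge0 (qb q1); lia.
have [q2' cl2 cop] := act_first_coprime a0 (fun p => disc_primitive nsf n4 D2).
have D2' := disc_in_class cl2; rewrite D2 in D2'.
have [b1 b1E] := disc_even D1; have [b2 b2E] := disc_even D2'.
have {}cop : coprimez (qa q1) (qa q2').
  by move: cop; rewrite coprimez_sym !coprimezE.
case: q1 b1E D1 cop {a0} => a1 ? c1 /= -> D1 cop.
case: q2' b2E D2' cl2 cop => a2 ? c2 /= -> D2' cl2 cop.
have [[u v] /= uv] := coprimezP _ _ cop.
have sh1 := class_shear a1 (2 * b1) c1 ((b2 - b1) * u).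
have sh2 := class_shear a2 (2 * b2) c2 ((b1 - b2) * v).
have E1 := disc_in_class sh1; have E2 := disc_in_class sh2.
rewrite D1 in E1; rewrite D2' in E2.
move: sh1 (class_trans cl2 sh2) E1 E2.
have -> : 2 * b2 + 2 * a2 * ((b1 - b2) * v) = 2 * (b1 + a1 * ((b2 - b1) * u)).
  transitivity (2 * b1 + 2 * (b2 - b1) * (u * a1 + v * a2) + 2 * a2 * ((b1 - b2) * v)).
    by rewrite uv; ring.
  by ring.
have -> : 2 * b1 + 2 * a1 * ((b2 - b1) * u) = 2 * (b1 + a1 * ((b2 - b1) * u)) by ring.
move: (_ + c1) (_ + c2) (b1 + _) => c1' c2' b {}cl1 {}cl2 /disc_BQF_half ac1 /disc_BQF_half ac2.
(* The Bezout form of [(b ^ 2 + n) / (a1 a2)], from [a1 c1' = a2 c2' = b ^ 2 + n]. *)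
exists a1, a2, b, (u * c2' + v * c1'); split=> //.
- have -> // : a2 * (u * c2' + v * c1') = c1'.
  transitivity (u * (a2 * c2') + v * a2 * c1'); first by ring.
  by rewrite ac2 -ac1 -[RHS]mul1r -uv; ring.
have -> // : a1 * (u * c2' + v * c1') = c2'.
transitivity (u * a1 * c2' + v * (a1 * c1')); first by ring.
by rewrite ac1 -ac2 -[RHS]mul1r -uv; ring.
Qed.

(** * Existence and discriminant of Legendre compositions *)

Lemma legendre_composition_class q1 q2 q1' q2' q :
  bqf_class q1 q1' -> bqf_class q2 q2' ->
  legendre_composition q1 q2 q -> legendre_composition q1' q2' q.
Proof.
move=> [g1 g1U E1] [g2 g2U E2] [mu [mus muE]].
exists (mu \o mulmxr g2 \o mulmx g1^T); split=> [w|u v] /=.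
  have [t <-] := mus w; exists (invmx g1^T *m t *m invmx g2).
  by rewrite !mulmxA mulmxV ?unitmx_tr // mul1mx mulmxKV.
by rewrite E1 E2 muE trmx_mul !mulmxA.
Qed.

(** The classical substitution [X = x0 y0 - c x1 y1], [Y = a1 x0 y1 + a2 x1 y0 + 2 b x1 y1];
    coprimality makes [Y] reach every integer. *)
Lemma dirichlet_composition a1 a2 b c : coprimez a1 a2 ->
  legendre_composition (BQF a1 (2 * b) (a2 * c)) (BQF a2 (2 * b) (a1 * c))
    (BQF (a1 * a2) (2 * b) c).
Proof.
move=> /coprimezP[[u v] /= uv].
pose mu : {linear 'M[int]_2 -> 'rV[int]_2} :=
  (mulmxr (mx2 1 0 0 a1) \o row 0) \+ (mulmxr (mx2 0 a2 (- c) (2 * b)) \o row 1).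
have muE t : mu t =
    rv2 (t 0 0 - c * t 1 1) (a1 * t 0 1 + a2 * t 1 0 + 2 * b * t 1 1).
  rewrite /mu /= [row 0 t]rv2E [row 1 t]rv2E !mul_rv2_mx2.
  by apply/rowP => i; rewrite !mxE; case: i => [[|[|]]] //= p; ring.
exists mu; split=> [w|x y].
  exists (mx2 (w 0 0) (u * w 0 1) (v * w 0 1) 0); rewrite muE [w in RHS]rv2E.
  rewrite !mxE /= ?mxE /=; congr rv2; first by ring.
  by rewrite -[RHS]mul1r -uv; ring.
by rewrite muE [x]rv2E [y]rv2E !bqf_rv2 !mxE !big_ord1 !mxE /=; ring.
Qed.

Lemma legendre_composition_exists (n : nat) (q1 q2 : bqf) :
  squarefree n -> (n = 1 %[mod 4])%N ->
  disc q1 = - (4 * n%:Z) -> disc q2 = - (4 * n%:Z) ->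
  exists q, legendre_composition q1 q2 q.
Proof.
move=> nsf n4 D1 D2.
have [a1 [a2 [b [c [cop cl1 cl2]]]]] := concordant_forms nsf n4 D1 D2.
exists (BQF (a1 * a2) (2 * b) c).
apply: legendre_composition_class (dirichlet_composition b c cop).
- exact: class_sym.
- exact: class_sym.
Qed.

(** After division by the gcd [g], the square of [m / g] is coprime to [j / g] and so divides
    [n]. *)
Lemma squarefree_dvdn_sqr n m j : squarefree n -> (0 < m)%N ->
  (m ^ 2 %| n * j ^ 2)%N -> (m %| j)%N.
Proof.
move=> nsf m0; set g := gcdn m j.
have g0 : (0 < g)%N by rewrite gcdn_gt0 m0.
have mE : (m %/ g * g = m)%N by rewrite divnK ?dvdn_gcdl.
have jE : (j %/ g * g = j)%N by rewrite divnK ?dvdn_gcdr.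
have cop : coprime (m %/ g) (j %/ g).
  by rewrite /coprime -(eqn_pmul2r g0) muln_gcdl mE jE mul1n.
rewrite -{1}mE -{1}jE !expnMn mulnA dvdn_pmul2r ?expn_gt0 ?g0 //.
rewrite Gauss_dvdl ?coprimeXl ?coprimeXr // => /nsf m1.
by rewrite -mE m1 mul1n dvdn_gcdr.
Qed.

(** For fixed [v], the map sending [u] to [mu (u (x) v)] pulls [q] back to [q2 v] times [q1]. This
    fixes the discriminant up to a square factor [s ^ 2], where [s] divides all values of the
    primitive form [q2]. *)
Lemma legendre_composition_disc (n : nat) (q1 q2 q : bqf) :
  squarefree n -> (n = 1 %[mod 4])%N ->
  disc q1 = - (4 * n%:Z) -> disc q2 = - (4 * n%:Z) ->
  legendre_composition q1 q2 q -> disc q = - (4 * n%:Z).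
Proof.
move=> nsf n4 D1 D2 [mu [_ muE]].
have n0 : n%:Z != 0 by case: n n4 {nsf D1 D2}.
pose M (v : 'rV[int]_2) : 'M[int]_2 := lin1_mx (mu \o mulmxr v \o trmx).
have ME v : \det (M v) ^+ 2 * disc q = - (4 * n%:Z) * q2 v ^+ 2.
  rewrite -disc_act -D1.
  have -> : bqf_act q (M v) = BQF (q2 v * qa q1) (q2 v * qb q1) (q2 v * qc q1).
    apply: bqf_ext => u; rewrite bqf_actE mul_rV_lin1 /= -muE mulrC.
    by rewrite /bqf_eval /=; ring.
  by rewrite /disc /=; ring.
have a0 : qa q2 != 0.
  apply/eqP => a0; move: D2 n0; rewrite /disc a0.
  have := sqr_ge0 (qb q2); lia.
have a2E : q2 (rv2 1 0) = qa q2 by rewrite bqf_rv2; ring.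
have := ME (rv2 1 0); rewrite a2E; set m := \det _ => Em.
have m0 : m != 0.
  apply: contra_neq a0 => m0; move/eqP: Em.
  by rewrite m0 expr0n mul0r eq_sym mulf_eq0 oppr_eq0 mulf_eq0 (negPf n0) sqrf_eq0 => /eqP.
(* [Em] shows that [m ^ 2] divides [n (2 qa q2) ^ 2], and [n] is squarefree. *)
have [t tE] : exists t, 2 * qa q2 = t * m.
  apply/dvdzP; rewrite dvdzE; apply: (@squarefree_dvdn_sqr n) => //.
    by rewrite absz_gt0.
  rewrite -!abszX -[n]/(`|n%:Z|)%N -abszM -dvdzE; apply/dvdzP; exists (- disc q).
  by rewrite mulNr [disc q * _]mulrC Em; ring.
have {Em} Dt : disc q = - (n%:Z * t ^+ 2).
  apply: (mulfI (_ : m ^+ 2 != 0)); first by rewrite sqrf_eq0.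
  rewrite Em; transitivity (- n%:Z * (2 * qa q2) ^+ 2); first by ring.
  by rewrite tE; ring.
(* A discriminant is 0 or 1 modulo 4, whereas [- n t ^ 2] is -1 modulo 4 for odd [t]. *)
have [s st] : exists s, t = 2 * s.
  have [k nk] : exists k : int, n%:Z = 4 * k + 1.
    by exists (n %/ 4)%N%:Z; have := divn_eq n 4; rewrite n4; lia.
  have half (x : int) : exists y, x = 2 * y \/ x = 2 * y + 1.
    by exists (x %/ 2)%Z; lia.
  have [s [|ts]] := half t; first by exists s.
  have [b be] := half (qb q); move: Dt; rewrite /disc nk ts.
  have -> : (4 * k + 1) * (2 * s + 1) ^+ 2 =
    4 * (k * (2 * s + 1) ^+ 2 + s ^+ 2 + s) + 1 by ring.
  move: (k * _ + _ + _) (qa q) (qc q) => z x y; case: be => ->.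
    have -> : (2 * b) ^+ 2 - 4 * x * y = 4 * (b ^+ 2 - x * y) by ring.
    lia.
  have -> : (2 * b + 1) ^+ 2 - 4 * x * y = 4 * (b ^+ 2 + b - x * y) + 1 by ring.
  lia.
have sdvd v : (s %| q2 v)%Z.
  have : q2 v ^+ 2 = (s * \det (M v)) ^+ 2.
    apply: (mulfI (_ : - (4 * n%:Z) != 0)); first by rewrite oppr_eq0 mulf_neq0.
    by rewrite -ME Dt st; ring.
  by move/eqP; rewrite eqf_sqr => /orP[] /eqP ->; rewrite ?rpredN dvdz_mulr.
suff s1 : s ^+ 2 = 1 by rewrite Dt st exprMn s1; ring.
suff s1 : `|s|%N = 1%N by rewrite -(real_normK (num_real s)) -abszE s1.
apply/eqP/negPn/negP => s1.
have s0 : (0 < `|s|)%N.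
  rewrite absz_gt0; apply: contra_neq a0 => s0.
  by apply/eqP; have := sdvd (rv2 1 0); rewrite a2E s0 dvd0z.
have pp : prime (pdiv `|s|) by apply: pdiv_prime; move: s0 s1; case: absz => [|[]].
have ps v : ((pdiv `|s|)%:Z %| q2 v)%Z.
  by apply: dvdz_trans (sdvd v); rewrite dvdzE pdiv_dvd.
apply: (disc_primitive nsf n4 D2 pp); split.
- by rewrite -a2E.
- have -> : qb q2 = q2 (rv2 1 1) - q2 (rv2 1 0) - q2 (rv2 0 1) by rewrite !bqf_rv2; ring.
  by rewrite !rpredB.
- by have -> : qc q2 = q2 (rv2 0 1) by rewrite bqf_rv2; ring.
Qed.

(** Completing the square shows that all nonzero values have the sign of [qa q], which one positive
    value determines. *)
Lemma positive_form_disc q (w : 'rV[int]_2) :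
  disc q < 0 -> 0 < q w -> positive_form q.
Proof.
move=> D qw.
have sq x : 4 * qa q * q x = (2 * qa q * x 0 0 + qb q * x 0 1) ^+ 2 - disc q * x 0 1 ^+ 2.
  by rewrite /bqf_eval /disc; ring.
have a0 : 0 < qa q.
  have a0 : qa q != 0.
    apply: contraTneq D => a0; rewrite /disc a0 mulr0 mul0r subr0 -leNgt; exact: sqr_ge0.
  rewrite lt_def a0 -(pmulr_lge0 _ (_ : 0 < 4 * q w)) ?mulr_gt0 //.
  have -> : qa q * (4 * q w) = 4 * qa q * q w by ring.
  rewrite sq.
  by rewrite addr_ge0 ?sqr_ge0 // -mulNr mulr_ge0 ?sqr_ge0 // oppr_ge0 ltW.
move=> x x0; rewrite -(pmulr_rgt0 _ (_ : 0 < 4 * qa q)); last by rewrite mulr_gt0.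
rewrite sq.
have [x1|x1] := eqVneq (x 0 1) 0.
  have x00 : x 0 0 != 0.
    apply: contra_neq x0 => x00; rewrite [x]rv2E x1 x00; apply/rowP => i; rewrite !mxE.
    by case: i => [[|[|]]].
  by rewrite x1 expr0n !mulr0 subr0 addr0 exprn_even_gt0 //= !mulf_neq0 // gt_eqF.
rewrite ltr_wpDl ?sqr_ge0 // -mulNr mulr_gt0 ?oppr_gt0 //.
by rewrite exprn_even_gt0.
Qed.

(** * Residues modulo the discriminant *)

Lemma dotzE k (u v : 'rV[int]_k) : dotz u v = (u *m v^T) 0 0.
Proof. by rewrite mxE; apply: eq_bigr => i _; rewrite mxE. Qed.

Lemma dotzC k (u v : 'rV[int]_k) : dotz u v = dotz v u.
Proof. by apply: eq_bigr => i _; rewrite mulrC. Qed.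

Lemma dotz_row k p r (A : 'M[int]_(p, k)) (B : 'M[int]_(r, k)) i j :
  dotz (row i A) (row j B) = (A *m B^T) i j.
Proof. by rewrite mxE; apply: eq_bigr => l _; rewrite !mxE. Qed.

Lemma dotzZl k c (u v : 'rV[int]_k) : dotz (c *: u) v = c * dotz u v.
Proof. by rewrite !dotzE -scalemxAl mxE. Qed.

Lemma dotzZr k c (u v : 'rV[int]_k) : dotz u (c *: v) = c * dotz u v.
Proof. by rewrite dotzC dotzZl dotzC. Qed.

(** Matrices with literal rows, so that products and transposes of explicit Gram matrices can be
    computed on lists. *)
Definition seqmx p r (s : seq (seq int)) : 'M[int]_(p, r) :=
  \matrix_(i, j) nth 0 (nth [::] s i) j.

Lemma rv4P (x : 'rV[int]_4) : exists p q r t, x = seqmx 1 4 [:: [:: p; q; r; t]].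
Proof.
exists (x 0 0), (x 0 1), (x 0 (inord 2)), (x 0 (inord 3)); apply/rowP => i; rewrite mxE /=.
by case: i => [[|[|[|[|]]]]] //= p; congr (x _ _); apply/val_inj; rewrite //= inordK.
Qed.

Lemma rv3P (x : 'rV[int]_3) : exists p q r, x = seqmx 1 3 [:: [:: p; q; r]].
Proof.
exists (x 0 0), (x 0 1), (x 0 (inord 2)); apply/rowP => i; rewrite mxE /=.
by case: i => [[|[|[|]]]] //= p; congr (x _ _); apply/val_inj; rewrite //= inordK.
Qed.

(** [l] is the first vector of the basis dual to the rows of [R]. *)
Lemma dual_vector k (R : 'M[int]_k.+1) c : R \in unitmx ->
  exists l, dotz l (c *: row 0 R) = c.
Proof.
move=> RU; exists (row 0 (invmx R)^T).
by rewrite dotzZr dotzC dotz_row trmxK mulmxV // mxE eqxx mulr1.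
Qed.

Lemma det_mx33 (A : 'M[int]_3) :
  let B i j := A (inord i) (inord j) in
  \det A = B 0%N 0%N * (B 1%N 1%N * B 2%N 2%N - B 1%N 2%N * B 2%N 1%N)
    - B 0%N 1%N * (B 1%N 0%N * B 2%N 2%N - B 1%N 2%N * B 2%N 0%N)
    + B 0%N 2%N * (B 1%N 0%N * B 2%N 1%N - B 1%N 1%N * B 2%N 0%N).
Proof.
move=> B; have AB i j : A i j = B i j by rewrite /B !inord_val.
do 2!rewrite !(expand_det_row _ ord0) !big_ord_recl !big_ord0 /cofactor.
by rewrite !det_mx11 !mxE !AB /= /bump /=; ring.
Qed.

Lemma det_seqmx4 (ll p s r x y z w : int) :
  \det (seqmx 4 4 [:: [:: ll; p; s; r]; [:: p; x; y; 0]; [:: s; y; z; 0]; [:: r; 0; 0; w]]) =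
  ll * w * (x * z - y ^+ 2) - p ^+ 2 * z * w + 2 * p * s * y * w - s ^+ 2 * x * w
    - r ^+ 2 * (x * z - y ^+ 2).
Proof.
rewrite (expand_det_row _ ord0) !big_ord_recl !big_ord0 /cofactor.
by rewrite !det_mx33 !mxE /= !inordK //= /bump /=; ring.
Qed.

(** In the Gram determinant of [l, u2, u1, w], which is the square of [\det A], every term but the
    one in [dotz l u2 ^+ 2] is divisible by [n]. *)
Lemma plane_residue (n a b c : int) (l u1 u2 w : 'rV[int]_4) :
  sumsq u1 = a -> dotz u1 u2 = n * b -> sumsq u2 = n * c ->
  dotz w u1 = 0 -> dotz w u2 = 0 ->
  exists t k, - (dotz l u2 ^+ 2 * a * sumsq w) = t ^+ 2 + n * k.
Proof.
move=> E11 E12 E22 w1 w2.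
pose A : 'M[int]_4 := \matrix_i nth 0 [:: l; u2; u1; w] i.
have AE : A *m A^T = seqmx 4 4 [:: [:: sumsq l; dotz l u2; dotz l u1; dotz l w];
    [:: dotz l u2; n * c; n * b; 0]; [:: dotz l u1; n * b; a; 0]; [:: dotz l w; 0; 0; sumsq w]].
  apply/matrixP => i j; rewrite -dotz_row !rowK mxE.
  by case: i => [[|[|[|[|]]]]] //= _; case: j => [[|[|[|[|]]]]] //= _;
    rewrite // dotzC.
have := congr1 (fun A => \det A) AE; rewrite det_mulmx det_tr det_seqmx4 -expr2 => D.
exists (\det A); rewrite D.
move: (dotz l u2) (dotz l u1) (dotz l w) (sumsq l) (sumsq w) => p s r ll ww.
exists (- (ll * ww * (c * a - n * b ^+ 2)
  + 2 * p * s * b * ww - s ^+ 2 * c * ww - r ^+ 2 * (c * a - n * b ^+ 2))).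
by ring.
Qed.

Lemma perp_residue (n : int) (l v y : 'rV[int]_3) : sumsq v = n -> dotz y v = 0 ->
  exists t k, - (dotz l v ^+ 2 * sumsq y) = t ^+ 2 + n * k.
Proof.
move=> <- yv.
pose A : 'M[int]_3 := \matrix_i nth 0 [:: l; v; y] i.
exists (\det A), (dotz l y ^+ 2 - sumsq l * sumsq y).
have AE : A *m A^T = seqmx 3 3 [:: [:: sumsq l; dotz l v; dotz l y];
    [:: dotz l v; sumsq v; 0]; [:: dotz l y; 0; sumsq y]].
  apply/matrixP => i j; rewrite -dotz_row !rowK mxE.
  by case: i => [[|[|[|]]]] //= _; case: j => [[|[|[|]]]] //= _; rewrite // dotzC.
have := congr1 (fun A => \det A) AE; rewrite det_mulmx det_tr -expr2 => ->.
by rewrite det_mx33 !mxE !inordK //=; ring.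
Qed.

Lemma basis_form_gram k (B : 'M[int]_(2, k)) :
  basis_form B = BQF ((B *m B^T) 0 0) (2 * (B *m B^T) 0 1) ((B *m B^T) 1 1).
Proof. by rewrite /basis_form !dotz_row. Qed.

Lemma disc_basis_form k (B : 'M[int]_(2, k)) :
  disc (basis_form B) = - (4 * \det (B *m B^T)).
Proof.
have G10 : (B *m B^T) 1 0 = (B *m B^T) 0 1 by rewrite -!dotz_row dotzC.
by rewrite basis_form_gram [X in \det X]mx2E det_mx2 G10 /disc /=; ring.
Qed.

(** The rational Gram matrix [C] is invertible, which yields a right inverse of [B]. *)
Lemma is_basis_range k (B : 'M[int]_(2, k)) :
  disc (basis_form B) != 0 -> is_basis (range (fun x : 'rV[int]_2 => x *m B)) B.
Proof.
move=> D; split=> //; apply/row_freeP.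
pose C : 'M[rat]_2 := map_mx intr (B *m B^T).
exists ((map_mx intr B)^T *m invmx C); rewrite mulmxA.
have -> : map_mx intr B *m (map_mx intr B)^T = C by rewrite /C map_mxM map_trmx.
rewrite mulmxV // unitmxE det_map_mx unitfE intr_eq0.
by apply: contra_neq D; rewrite disc_basis_form => ->; rewrite mulr0 oppr0.
Qed.

Lemma orth_primitive k (S : set 'rV[int]_k) : primitive_lattice (orth S).
Proof.
apply/seteqP; split=> [x [m [c [A [AS xE]]]] y Sy|x xS] /=; last first.
  exists 1%N, 1%:M, x; split; last by rewrite mul1mx.
  by move=> i; rewrite (_ : row i x = x) //; apply/rowP => j; rewrite mxE (ord1 i).
have Ay : A *m y^T = 0.
  apply/matrixP => i j; rewrite (ord1 j) [RHS]mxE; transitivity (dotz (row i A) y); last exact: AS.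
  by rewrite mxE; apply: eq_bigr => l _; rewrite !mxE.
apply/eqP; rewrite -(intr_eq0 rat); apply/eqP.
have : map_mx intr (x *m y^T) = 0 :> 'M[rat]_1.
  by rewrite map_mxM xE -mulmxA -map_mxM Ay map_mx0 mulmx0.
by move=> /matrixP/(_ 0 0); rewrite dotzE !mxE.
Qed.

Lemma lattice_form_basis k (L : set 'rV[int]_k) : sublattice2 L ->
  exists2 B, is_basis L B & lattice_form L = basis_form B.
Proof. by move=> LB; exists (xget 0 [set B | is_basis L B]) => //; exact: xgetPex. Qed.

(* If [orth S] had no basis, the junk value of [xget] would be [B = 0]. *)
Lemma lattice_form_orth k (S : set 'rV[int]_k) :
  exists2 B, lattice_form (orth S) = basis_form B & forall x, orth S (x *m B).
Proof.
exists (xget 0 [set B | is_basis (orth S) B]) => // x.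
have [ex|nex] := pselect (exists B, is_basis (orth S) B).
  have [_ E] := xgetPex 0 ex.
  by rewrite [X in X (x *m _)]E; exists x.
rewrite xgetPN => [|B BS]; last by apply: nex; exists B.
by rewrite mulmx0 => y _; rewrite dotzE mul0mx mxE.
Qed.

Lemma basis_unimodular k (L : set 'rV[int]_k) B (g : 'M[int]_2) :
  g \in unitmx -> is_basis L B -> is_basis L (g *m B).
Proof.
move=> gU [Bf LB]; split.
  rewrite map_mxM /row_free mxrankMfree //.
  by rewrite mxrank_unit // unitmxE det_map_mx rmorph_unit // -unitmxE.
rewrite LB; apply/seteqP; split=> _ [x _ <-].
  by exists (x *m invmx g) => //; rewrite mulmxA mulmxKV.
by exists (x *m g); rewrite ?mulmxA.
Qed.

(** If a basis vector is [c] times an integral vector, primitivity puts that vector in [L];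
    comparing coordinates in the basis gives [c = 1] or [c = -1], and a dual vector pairs to [c]. *)
Lemma primitive_basis_dual k (L : set 'rV[int]_k.+1) B i :
  primitive_lattice L -> is_basis L B -> exists l, dotz l (row i B) ^+ 2 = 1.
Proof.
move=> Lp [Bf LB]; have [c [R RU E]] := row_unimodular (row i B).
have [l lE] := dual_vector c RU; exists l; rewrite E lE.
have Lrow : L (row i B) by rewrite LB; exists (delta_mx 0 i) => //; rewrite rowE.
have c0 : c != 0.
  apply/eqP => c0; move: E; rewrite c0 scale0r => E.
  have /(row_free_inj Bf)/matrixP/(_ 0 i) :
      map_mx intr (delta_mx 0 i) *m map_mx intr B = 0 *m map_mx intr B :> 'rV[rat]_k.+1.
    by rewrite -map_mxM -rowE E map_mx0 mul0mx.
  by rewrite !mxE !eqxx.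
have : L (row 0 R).
  rewrite -Lp; exists 1%N, (const_mx (c%:~R^-1)), (row i B); split.
    by move=> j; rewrite (_ : row j _ = row i B) //; apply/rowP => ?; rewrite !mxE.
  rewrite E; apply/rowP => j; rewrite !mxE big_ord1 !mxE rmorphM /= mulKf //.
  by rewrite intr_eq0.
rewrite LB => -[x _ xE].
have /(row_free_inj Bf) : map_mx intr (c *: x) *m map_mx intr B =
    map_mx intr (delta_mx 0 i) *m map_mx intr B :> 'rV[rat]_k.+1.
  by rewrite -!map_mxM -scalemxAl xE -E -rowE.
move=> /matrixP/(_ 0 i); rewrite !mxE !eqxx => /intr_inj cx.
have : (c %| 1)%Z by apply/dvdzP; exists (x 0 i); rewrite mulrC cx.
by rewrite dvdz1 => c1; rewrite -(real_normK (num_real c)) -abszE (eqP c1).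
Qed.

Lemma lattice_pair_residue (n a b c : int) (q2 : bqf) (L : set 'rV[int]_4) :
  sublattice2 L -> primitive_lattice L ->
  bqf_class (lattice_form L) = bqf_class (BQF a (2 * (n * b)) (n * c)) ->
  bqf_class (lattice_form (orth L)) = bqf_class q2 ->
  forall y, exists t k, - (a * q2 y) = t ^+ 2 + n * k.
Proof.
move=> Lb Lp E1 E2 y.
have [B LB LE] := lattice_form_basis Lb; have [C CE CL] := lattice_form_orth L.
have [g gU gE] : bqf_class (basis_form B) (BQF a (2 * (n * b)) (n * c)).
  by rewrite -LE E1; exact: bqf_class_refl.
have [h _ hE] : bqf_class (basis_form C) q2 by rewrite -CE E2; exact: bqf_class_refl.
have gLB := basis_unimodular gU LB.
have : basis_form (g *m B) = BQF a (2 * (n * b)) (n * c).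
  by apply: bqf_ext => x; rewrite gE !basis_formE mulmxA.
case=> e11 /(mulfI (isT : (2 : int) != 0)) e12 e22.
(* Index 1 selects the basis vector in the radical modulo [n], so that [dotz l u2 ^+ 2] disappears
   from the residue. *)
have [l l1] := primitive_basis_dual 1 Lp gLB.
have Lrow i : L (row i (g *m B)) by rewrite gLB.2; exists (delta_mx 0 i) => //; rewrite rowE.
have [t [k tk]] := plane_residue l e11 e12 e22 (CL (y *m h) _ (Lrow 0)) (CL (y *m h) _ (Lrow 1)).
by exists t, k; rewrite -tk l1 mul1r hE basis_formE.
Qed.

Lemma GG_residue (n : nat) (q : bqf) : squarefree n -> (0 < n)%N ->
  GG n (bqf_class q) -> forall y, exists t k, - q y = t ^+ 2 + n%:Z * k.
Proof.
move=> nsf n0 [v vn qE] y.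
have [B BE Bo] := lattice_form_orth [set v].
have [h _ hE] : bqf_class (basis_form B) q by rewrite -BE -qE; exact: bqf_class_refl.
have [c [R RU E]] := row_unimodular v.
have [l lE] := dual_vector c RU; rewrite -E in lE.
(* [c ^ 2] divides the squarefree norm [n] of [v], so [v] is primitive. *)
have c1 : c ^+ 2 = 1.
  suff c1 : `|c|%N = 1%N by rewrite -(real_normK (num_real c)) -abszE c1.
  apply: nsf; rewrite -(absz_nat n) -abszX -dvdzE; apply/dvdzP.
  exists (sumsq (row 0 R)); rewrite -vn E /sumsq dotzZl dotzZr; ring.
have [t [k tk]] := perp_residue l vn (Bo (y *m h) v erefl).
by exists t, k; rewrite -tk lE c1 mul1r hE basis_formE.
Qed.

(** * Gluing *)

Lemma mul_seqmx p r l s t :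
  seqmx p r s *m seqmx r l t =
  seqmx p l [seq [seq \sum_(k < r) nth 0 (nth [::] s i) k * nth 0 (nth [::] t k) j
                 | j <- iota 0 l] | i <- iota 0 p].
Proof.
apply/matrixP => i j; rewrite !mxE (nth_map 0%N) ?size_iota // nth_iota //.
rewrite (nth_map 0%N) ?size_iota // nth_iota //.
by apply: eq_bigr => k _; rewrite !mxE.
Qed.

Lemma tr_seqmx p r s :
  (seqmx p r s)^T = seqmx r p [seq [seq nth 0 (nth [::] s i) j | i <- iota 0 p] | j <- iota 0 r].
Proof.
apply/matrixP => i j; rewrite !mxE (nth_map 0%N) ?size_iota // nth_iota //.
by rewrite (nth_map 0%N) ?size_iota // nth_iota.
Qed.

Lemma scalar_seqmx p : 1%:M = seqmx p p [seq [seq (i == j)%:R | j <- iota 0 p] | i <- iota 0 p].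
Proof.
apply/matrixP => i j; rewrite !mxE (nth_map 0%N) ?size_iota // nth_iota //.
by rewrite (nth_map 0%N) ?size_iota // nth_iota.
Qed.

(** [k1], [k2], [k3] are the cofactors of an ideal membership certificate, which leaves a polynomial
    identity to [ring]. *)
Lemma lincomb (x y r1 r2 r3 l1 l2 l3 k1 k2 k3 : int) : l1 = r1 -> l2 = r2 -> l3 = r3 ->
  x - y = k1 * (l1 - r1) + k2 * (l2 - r2) + k3 * (l3 - r3) -> x = y.
Proof.
move=> -> -> ->; rewrite !subrr !mulr0 !addr0 => /eqP.
by rewrite subr_eq0 => /eqP.
Qed.

Lemma sqr_unimodular k (U G H : 'M[int]_k) : U *m U^T = G -> G *m H = 1%:M -> U \in unitmx.
Proof.
by move=> UG GH; apply: (mulmx1_unit (_ : U *m (U^T *m H) = 1%:M)).1; rewrite mulmxA UG.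
Qed.

(* The forms are glued along [g = (e2 + s f2) / n]; the glued lattice has basis
   [e1, f1, f2, g]. *)
Section Glue.

Variables n a b c a' b' c' s h : int.
Hypotheses (n0 : n != 0) (det1 : a * c = 1 + n * b ^+ 2).
Hypothesis det2 : a' * c' = 1 + n * b' ^+ 2.
Hypothesis glue : n * h = c + s ^+ 2 * c'.
Hypothesis pos1 : positive_form (BQF a (2 * (n * b)) (n * c)).
Hypothesis pos2 : positive_form (BQF a' (2 * (n * b')) (n * c')).

(** The norm of [g] is [(n c + s ^ 2 n c') / n ^ 2], equal to [h] by [glue]; its products with [e1],
    [f1], [f2] are [b], [s b'], [s c']. *)
Definition glue_gram : 'M[int]_4 := seqmx 4 4
  [:: [:: a; 0; 0; b]; [:: 0; a'; n * b'; s * b']; [:: 0; n * b'; n * c'; s * c'];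
      [:: b; s * b'; s * c'; h]].

Definition glue_dual : 'M[int]_4 := seqmx 4 4
  [:: [:: c; 0; b * s; - (b * n)]; [:: 0; c'; - b'; 0];
      [:: s * b; - b'; a * a' * h - a' * b ^+ 2 - s ^+ 2 * a * b' ^+ 2; - (s * a)];
      [:: - (n * b); 0; - (a * s); a * n]].

Lemma glue_gram_dual : glue_gram *m glue_dual = 1%:M.
Proof.
have lc k1 k2 k3 x y := @lincomb x y _ _ _ _ _ _ k1 k2 k3 det1 det2 glue.
rewrite mul_seqmx scalar_seqmx /= !big_ord_recl !big_ord0 /=.
congr (seqmx _ _ [:: [:: _; _; _; _]; [:: _; _; _; _]; [:: _; _; _; _];
  [:: _; _; _; _]]); try ring.
- by apply: (lc 1 0 0); ring.
- by apply: (lc 0 1 0); ring.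
- by apply: (lc (b' * a') (b' * s ^+ 2 * a) (b' * a * a')); ring.
- by apply: (lc (c' * a') (1 + c' * s ^+ 2 * a) (c' * a * a')); ring.
- by apply: (lc 0 0 (- b)); ring.
- by apply: (lc (s * b' ^+ 2) (s * (a * h - b ^+ 2)) (s * a * b' ^+ 2)); ring.
- by apply: (lc 1 0 a); ring.
Qed.

Lemma glue_gram_sym : glue_gram^T = glue_gram.
Proof. by rewrite tr_seqmx. Qed.

Lemma orth_rangeP k (B : 'M[int]_(2, k)) w :
  orth (range (fun x : 'rV[int]_2 => x *m B)) w <-> w *m B^T = 0.
Proof.
split=> [wB|wB _ [x _ <-]]; last by rewrite dotzE trmx_mul mulmxA wB mul0mx mxE.
apply/matrixP => i j; rewrite (ord1 i) [RHS]mxE; transitivity (dotz w (row j B)).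
  by rewrite mxE; apply: eq_bigr => l _; rewrite !mxE.
by apply: wB; exists (delta_mx 0 j); rewrite // rowE.
Qed.

Lemma rv2_neq0 x y : (x != 0) || (y != 0) -> rv2 x y != 0.
Proof.
move=> xy; apply/eqP => /matrixP E; move: (E 0 0) (E 0 1) xy.
by rewrite rv2_0 rv2_1 !mxE => -> ->; rewrite eqxx.
Qed.

(** Multiplication by [n] carries a vector into the orthogonal sum of the two planes, with
    components [u] and [v]. *)
Lemma glue_gram_posdef : posdef glue_gram.
Proof.
move=> w; have [x [y [z [t ->]]]] := rv4P w => {w} x0.
pose u := rv2 (n * x) t; pose v := rv2 (n * y) (n * z + s * t).
have E : n ^+ 2 * quad glue_gram (seqmx 1 4 [:: [:: x; y; z; t]]) =
    BQF a (2 * (n * b)) (n * c) u + BQF a' (2 * (n * b')) (n * c') v.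
  rewrite /quad tr_seqmx !mul_seqmx !bqf_rv2 mxE /= !big_ord_recl !big_ord0 /=.
  by apply: (@lincomb _ _ _ _ _ _ _ _ 0 0 (n * t ^+ 2) det1 det2 glue); ring.
rewrite -(pmulr_rgt0 _ (_ : 0 < n ^+ 2)) ?exprn_even_gt0 // E.
have ge0 q w : positive_form q -> 0 <= q w.
  move=> qp; have [->|/qp/ltW//] := eqVneq w 0.
  by rewrite /bqf_eval !mxE expr0n !mulr0 !addr0.
have [u0|u0] := eqVneq u 0; last first.
  by rewrite ltr_wpDr ?pos1 ?ge0.
rewrite ltr_wpDl ?ge0 ?pos2 // rv2_neq0 //.
apply: contra_neqT x0; rewrite negb_or !negbK => /andP[].
have : n * x = 0 by rewrite -(rv2_0 (n * x) t) -/u u0 mxE.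
have : t = 0 by rewrite -(rv2_1 (n * x) t) -/u u0 mxE.
move=> -> /eqP; rewrite mulf_eq0 (negPf n0) /= => /eqP ->.
rewrite mulr0 addr0 !mulf_eq0 (negPf n0) /= => /eqP -> /eqP ->.
by apply/rowP => i; rewrite !mxE; case: i => [[|[|[|[|]]]]].
Qed.

Lemma glue_lattice : exists L : set 'rV[int]_4,
  [/\ sublattice2 L, primitive_lattice L,
      bqf_class (lattice_form L) = bqf_class (BQF a (2 * (n * b)) (n * c))
    & bqf_class (lattice_form (orth L)) = bqf_class (BQF a' (2 * (n * b')) (n * c'))].
Proof.
have [|U UG] := unimodular_sum_of_squares (isT : (4 <= 4)%N) glue_gram_sym glue_gram_posdef.
  by case/mulmx1_unit: glue_gram_dual.
have UU := sqr_unimodular UG glue_gram_dual.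
(* In the basis [[e1, f1, f2, g]], the rows of [S] are [e1] and [e2 = n g - s f2], those of [T] are
   [f1] and [f2]. *)
pose S := seqmx 2 4 [:: [:: 1; 0; 0; 0]; [:: 0; 0; - s; n]].
pose T := seqmx 2 4 [:: [:: 0; 1; 0; 0]; [:: 0; 0; 1; 0]].
have SF : basis_form (S *m U) = BQF a (2 * (n * b)) (n * c).
  rewrite basis_form_gram trmx_mul -mulmxA (mulmxA U) UG tr_seqmx !mul_seqmx !mxE /=.
  rewrite !big_ord_recl !big_ord0 /=; congr BQF; try ring.
  by apply: (@lincomb _ _ _ _ _ _ _ _ 0 0 n det1 det2 glue); ring.
have TF : basis_form (T *m U) = BQF a' (2 * (n * b')) (n * c').
  rewrite basis_form_gram trmx_mul -mulmxA (mulmxA U) UG tr_seqmx !mul_seqmx !mxE /=.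
  by rewrite !big_ord_recl !big_ord0 /=; congr BQF; ring.
have GE (R : 'M[int]_(2, 4)) y : y *m U *m (R *m U)^T = y *m (glue_gram *m R^T).
  by rewrite trmx_mul !mulmxA -(mulmxA y) UG.
have SO : orth (range (fun x : 'rV[int]_2 => x *m (S *m U))) =
    range (fun x : 'rV[int]_2 => x *m (T *m U)).
  apply/seteqP; split=> w.
    move/orth_rangeP; rewrite -(mulmxKV UU w) GE.
    have [p [q [r [t ->]]]] := rv4P (w *m invmx U).
    rewrite tr_seqmx !mul_seqmx /= !big_ord_recl !big_ord0 /= => /matrixP E.
    move: (E 0 0) (E 0 1); rewrite !mxE /= => {}E E1; exists (rv2 q r) => //.
    (* With [E], a linear system in [p], [t] of determinant [a c - n b ^ 2 = 1]. *)
    have {}E1 : n * b * p + c * t = 0.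
      by apply: (@lincomb _ _ _ _ _ _ _ _ 1 0 (- t) E1 det2 glue); ring.
    have p0 : p = 0.
      by apply: (@lincomb _ _ _ _ _ _ _ _ c (- b) (- p) E E1 det1); ring.
    have t0 : t = 0.
      by apply: (@lincomb _ _ _ _ _ _ _ _ (- n * b) a (- t) E E1 det1); ring.
    rewrite p0 t0 mulmxA; congr (_ *m _); apply/rowP => i.
    rewrite !mxE !big_ord_recl !big_ord0 !mxE.
    by case: i => [[|[|[|[|]]]]] //= _; ring.
  move=> [x _ <-]; apply/orth_rangeP; rewrite mulmxA GE -mulmxA.
  rewrite tr_seqmx !mul_seqmx /= !big_ord_recl !big_ord0 /=.
  rewrite (_ : seqmx _ _ _ = 0) ?mulmx0 //; apply/matrixP => i j; rewrite !mxE.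
  by case: i => [[|[|]]] //= _; case: j => [[|[|]]] //= _; ring.
have TO : orth (range (fun x : 'rV[int]_2 => x *m (T *m U))) =
    range (fun x : 'rV[int]_2 => x *m (S *m U)).
  apply/seteqP; split=> w; last first.
    by move=> wS y yT; rewrite dotzC; move: w wS; rewrite -SO in yT; exact: yT.
  move/orth_rangeP; rewrite -(mulmxKV UU w) GE.
  have [p [q [r [t ->]]]] := rv4P (w *m invmx U).
  rewrite tr_seqmx !mul_seqmx /= !big_ord_recl !big_ord0 /= => /matrixP E.
  move: (E 0 0) (E 0 1); rewrite !mxE /= => {}E E1.
  have q0 : q = 0.
    by apply: (@lincomb _ _ _ _ _ _ _ _ c' (- b') (- q) E E1 det2); ring.
  have rt : n * r + s * t = 0.
    by apply: (@lincomb _ _ _ _ _ _ _ _ (- n * b') a' (- (n * r + s * t)) E E1 det2); ring.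
  (* [det1] and [glue] give [1 = n (a h - b ^ 2) - a c' s ^ 2]; multiplied by [t], with
     [s t = - n r], this exhibits [t] as a multiple of [n]. *)
  pose k := t * (a * h - b ^+ 2) + a * c' * s * r.
  have tk : t = n * k.
    by apply: (@lincomb _ _ _ _ _ _ _ _ (- t) (- a * t) (- (a * c' * s)) det1 glue rt);
      rewrite /k; ring.
  have rk : r = - s * k.
    by apply: (mulfI n0); apply: (@lincomb _ _ _ _ _ _ _ _ 0 1 (- s) det1 rt tk); ring.
  exists (rv2 p k) => //; rewrite q0 tk rk mulmxA; congr (_ *m _).
  apply/rowP => i; rewrite !mxE !big_ord_recl !big_ord0 !mxE.
  by case: i => [[|[|[|[|]]]]] //= _; ring.
have disc0 x y z : x * z = 1 + n * y ^+ 2 -> disc (BQF x (2 * (n * y)) (n * z)) != 0.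
  move=> xz; rewrite /disc /= (_ : _ - _ = - (4 * n)) ?oppr_eq0 ?mulf_neq0 //.
  by apply: (@lincomb _ _ _ _ _ _ _ _ (- (4 * n)) 0 0 xz xz xz); ring.
have SB := is_basis_range (_ : disc (basis_form (S *m U)) != 0).
have TB := is_basis_range (_ : disc (basis_form (T *m U)) != 0).
rewrite SF TF in SB TB.
exists (range (fun x : 'rV[int]_2 => x *m (S *m U))); split.
- by exists (S *m U); exact/SB/disc0.
- by rewrite -TO; exact: orth_primitive.
- by rewrite (lattice_form_class (SB (disc0 _ _ _ det1))) SF.
- by rewrite SO (lattice_form_class (TB (disc0 _ _ _ det2))) TF.
Qed.

End Glue.

(* The same gluing, of [<n>] with a binary form: here [g = (v + s f2) / n] with
   [v] of norm [n]. *)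
Section GlueLine.

Variables n a b c s h : int.
Hypotheses (n0 : n != 0) (det1 : a * c = 1 + n * b ^+ 2).
Hypothesis glue : n * h = 1 + s ^+ 2 * c.
Hypothesis pos : positive_form (BQF a (2 * (n * b)) (n * c)).

(** The basis is [[f1, f2, g]], and [h = (n + s ^ 2 n c) / n ^ 2] is the norm of [g]. *)
Definition line_gram : 'M[int]_3 := seqmx 3 3
  [:: [:: a; n * b; s * b]; [:: n * b; n * c; s * c]; [:: s * b; s * c; h]].

Definition line_dual : 'M[int]_3 := seqmx 3 3
  [:: [:: c; - b; 0]; [:: - b; a * h - s ^+ 2 * b ^+ 2; - s]; [:: 0; - s; n]].

Lemma line_gram_dual : line_gram *m line_dual = 1%:M.
Proof.
have lc k1 k2 x y := @lincomb x y _ _ _ _ _ _ k1 k2 0 det1 glue det1.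
rewrite mul_seqmx scalar_seqmx /= !big_ord_recl !big_ord0 /=.
congr (seqmx _ _ [:: [:: _; _; _]; [:: _; _; _]; [:: _; _; _]]); try ring.
- by apply: (lc 1 0); ring.
- by apply: (lc (b * s ^+ 2) (a * b)); ring.
- by apply: (lc (n * h) (1 + n * b ^+ 2)); ring.
- by apply: (lc (s * h) (s * b ^+ 2)); ring.
- by apply: (lc 0 1); ring.
Qed.

Lemma line_gram_sym : line_gram^T = line_gram.
Proof. by rewrite tr_seqmx. Qed.

Lemma line_gram_posdef : 0 < n -> posdef line_gram.
Proof.
move=> ngt0 w; have [x [y [z ->]]] := rv3P w => {w} x0.
pose u := rv2 (n * x) (n * y + s * z).
have E : n ^+ 2 * quad line_gram (seqmx 1 3 [:: [:: x; y; z]]) =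
    BQF a (2 * (n * b)) (n * c) u + n * z ^+ 2.
  rewrite /quad tr_seqmx !mul_seqmx !bqf_rv2 mxE /= !big_ord_recl !big_ord0 /=.
  by apply: (@lincomb _ _ _ _ _ _ _ _ 0 (n * z ^+ 2) 0 det1 glue det1); ring.
rewrite -(pmulr_rgt0 _ (_ : 0 < n ^+ 2)) ?exprn_gt0 // E.
have [z0|z0] := eqVneq z 0; last first.
  rewrite ltr_wpDl //; last by rewrite mulr_gt0 // exprn_even_gt0.
  have [->|/pos/ltW//] := eqVneq u 0.
  by rewrite /bqf_eval !mxE expr0n !mulr0 !addr0.
rewrite z0 expr0n !mulr0 addr0 pos // /u z0 rv2_neq0 //.
apply: contra_neqT x0; rewrite negb_or !negbK mulr0 addr0 !mulf_eq0 (negPf n0) /=.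
move=> /andP[/eqP -> /eqP ->]; rewrite z0.
by apply/rowP => i; rewrite !mxE; case: i => [[|[|[|]]]].
Qed.

Lemma glue_line : 0 < n -> exists2 v : 'rV[int]_3, sumsq v = n &
  bqf_class (lattice_form (orth [set v])) = bqf_class (BQF a (2 * (n * b)) (n * c)).
Proof.
move=> ngt0.
have [|U UG] := unimodular_sum_of_squares (isT : (3 <= 4)%N) line_gram_sym
    (line_gram_posdef ngt0).
  by case/mulmx1_unit: line_gram_dual.
have UU := sqr_unimodular UG line_gram_dual.
(* [e] is [v = n g - s f2]; by [glue], pairing with it reads off the coordinate along [g]. *)
pose e := seqmx 1 3 [:: [:: 0; - s; n]].
pose T := seqmx 2 3 [:: [:: 1; 0; 0]; [:: 0; 1; 0]].
have TF : basis_form (T *m U) = BQF a (2 * (n * b)) (n * c).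
  rewrite basis_form_gram trmx_mul -mulmxA (mulmxA U) UG tr_seqmx !mul_seqmx !mxE /=.
  by rewrite !big_ord_recl !big_ord0 /=; congr BQF; ring.
have dot_e p q r : dotz (seqmx 1 3 [:: [:: p; q; r]] *m U) (e *m U) = r.
  rewrite dotzE trmx_mul -mulmxA (mulmxA U) UG tr_seqmx !mul_seqmx !mxE /=.
  rewrite !big_ord_recl !big_ord0 /=.
  by apply: (@lincomb _ _ _ _ _ _ _ _ 0 r 0 det1 glue det1); ring.
have TO : orth [set e *m U] = range (fun x : 'rV[int]_2 => x *m (T *m U)).
  apply/seteqP; split=> w.
    move=> /(_ _ erefl); rewrite -(mulmxKV UU w).
    have [p [q [r ->]]] := rv3P (w *m invmx U); rewrite dot_e => ->.
    exists (rv2 p q) => //; rewrite mulmxA; congr (_ *m _).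
    apply/rowP => i; rewrite !mxE !big_ord_recl !big_ord0 !mxE.
    by case: i => [[|[|[|]]]] //= _; ring.
  move=> [x _ <-] _ ->; rewrite [x]rv2E mulmxA.
  rewrite (_ : _ *m T = seqmx 1 3 [:: [:: x 0 0; x 0 1; 0]]) ?dot_e //.
  apply/rowP => i; rewrite !mxE !big_ord_recl !big_ord0 !mxE.
  by case: i => [[|[|[|]]]] //= _; ring.
exists (e *m U); first by rewrite /sumsq dot_e.
rewrite TO -TF; apply/lattice_form_class/is_basis_range.
rewrite TF /disc /= (_ : _ - _ = - (4 * n)) ?oppr_eq0 ?mulf_neq0 //.
by apply: (@lincomb _ _ _ _ _ _ _ _ (- (4 * n)) 0 0 det1 det1 det1); ring.
Qed.

End GlueLine.

(** * From residues to lattices, and the equivalence *)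

Lemma residue_GG (n : nat) (q : bqf) (w : 'rV[int]_2) :
  squarefree n -> (n = 1 %[mod 4])%N -> positive_form q -> disc q = - (4 * n%:Z) ->
  coprimez (q w) n%:Z -> (exists t k, - q w = t ^+ 2 + n%:Z * k) ->
  GG n (bqf_class q).
Proof.
move=> nsf n4 qpos D qwn [t [k qwt]].
have n0 : 0 < n%:Z by case: n n4 {nsf D qwn qwt}.
have [a [b [c [ac cl]]]] := normal_form nsf n4 D.
have [g gU gE] := class_sym cl.
rewrite gE [w *m g]rv2E bqf_rv2 /= in qwn qwt.
move: (_ 0 0) (_ 0 1) qwn qwt => x y /coprimezP[[u v] /= uv] qwt.
(* [u] inverts [q w] modulo [n], so [u a x ^ 2] is 1 and [s ^ 2] is [- a] modulo [n]; since [a c] is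
   1, [s ^ 2 c] is -1, as gluing requires. *)
pose s := t * u * a * x.
pose e := u * (2 * b * x * y + c * y ^+ 2) + v.
have ex : u * a * x ^+ 2 = 1 - n%:Z * e.
  by apply: (@lincomb _ _ _ _ _ _ _ _ 1 0 0 uv uv uv); rewrite /e; ring.
pose h := 2 * e - n%:Z * e ^+ 2 - b ^+ 2 * (1 - n%:Z * e) ^+ 2 -
  u ^+ 2 * a ^+ 2 * x ^+ 2 * c * (2 * b * x * y + c * y ^+ 2 + k).
have glue : n%:Z * h = 1 + s ^+ 2 * c.
  apply: (@lincomb _ _ _ _ _ _ _ _ (u ^+ 2 * a ^+ 2 * x ^+ 2 * c) ((u * a * x ^+ 2) ^+ 2)
    ((1 + n%:Z * b ^+ 2) * (u * a * x ^+ 2 + (1 - n%:Z * e))) qwt ac ex).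
  by rewrite /h /s; ring.
have pos' : positive_form (BQF a (2 * (n%:Z * b)) (n%:Z * c)).
  have [f fU fE] := cl; move=> z z0; rewrite fE; exact/qpos/mulmx_unit_neq0.
have [v' v'n v'E] := glue_line (lt0r_neq0 n0) ac glue pos' n0.
by exists v' => //; rewrite v'E (bqf_class_eq cl).
Qed.

Lemma residue_lattice_pair (n : nat) (q1 q2 : bqf) :
  squarefree n -> (n = 1 %[mod 4])%N -> positive_form q1 -> positive_form q2 ->
  disc q1 = - (4 * n%:Z) -> disc q2 = - (4 * n%:Z) ->
  (forall x y, exists t k, - (q1 x * q2 y) = t ^+ 2 + n%:Z * k) ->
  exists L : set 'rV[int]_4,
  [/\ sublattice2 L, primitive_lattice L, bqf_class (lattice_form L) = bqf_class q1
    & bqf_class (lattice_form (orth L)) = bqf_class q2].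
Proof.
move=> nsf n4 pos1 pos2 D1 D2 R.
have n0 : n%:Z != 0 by case: n n4 {nsf D1 D2 R}.
have [a [b [c [ac cl1]]]] := normal_form nsf n4 D1.
have [a' [b' [c' [ac' cl2]]]] := normal_form nsf n4 D2.
rewrite (bqf_class_eq cl1) (bqf_class_eq cl2).
have [g1 g1U g1E] := cl1; have [g2 g2U g2E] := cl2.
have [t [k]] := R (rv2 1 0 *m g1) (rv2 1 0 *m g2).
rewrite -g1E -g2E !bqf_rv2 /= => tk.
have aa : - (a * a') = t ^+ 2 + n%:Z * k by rewrite -tk; ring.
(* Here [s = c t]: modulo [n], [s ^ 2 c'] is [- c ^ 2 a a' c'], hence [- c], because [a c] and
   [a' c'] are 1. *)
have glue : n%:Z * (- (c * b ^+ 2) - c ^+ 2 * a * b' ^+ 2 - c ^+ 2 * c' * k) =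
    c + (c * t) ^+ 2 * c'.
  by apply: (@lincomb _ _ _ _ _ _ _ _ (c ^+ 2 * c') (c) (c ^+ 2 * a) aa ac ac'); ring.
apply: glue_lattice ac ac' glue _ _ => //.
- by move=> z z0; rewrite g1E; exact/pos1/mulmx_unit_neq0.
- by move=> z z0; rewrite g2E; exact/pos2/mulmx_unit_neq0.
Qed.

Theorem theorem7p9 (n : nat) (hD : n \in DD) (hsf : squarefree n)
    (hn4 : (n = 1 %[mod 4])%N)
    (q1 q2 : bqf) (pos1 : positive_form q1) (pos2 : positive_form q2)
    (disc1 : disc q1 = - (4 * n%:Z)) (disc2 : disc q2 = - (4 * n%:Z)) :
  (exists L : set 'rV[int]_4,
     [/\ sublattice2 L,
         primitive_lattice L,
         disc (lattice_form L) = - (4 * n%:Z),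
         bqf_class (lattice_form L) = bqf_class q1
       & bqf_class (lattice_form (orth L)) = bqf_class q2])
  <->
  (forall q : bqf, legendre_composition q1 q2 q -> GG n (bqf_class q)).
Proof.
have n0 : (0 < n)%N by case: n hn4 {hD hsf disc1 disc2}.
split=> [[L [Lb Lp _ L1 L2]] q comp|compGG]; last first.
  have [q comp] := legendre_composition_exists hsf hn4 disc1 disc2.
  have R := GG_residue hsf n0 (compGG q comp).
  have [mu [_ muE]] := comp.
  have [|L [Lb Lp L1 L2]] := residue_lattice_pair hsf hn4 pos1 pos2 disc1 disc2.
    by move=> x y; rewrite muE.
  by exists L; split=> //; rewrite (disc_class L1).
have D := legendre_composition_disc hsf hn4 disc1 disc2 comp.
have [mu [_ muE]] := comp.
have prim1 p := @disc_primitive n hsf hn4 q1 p disc1.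
have prim2 p := @disc_primitive n hsf hn4 q2 p disc2.
(* Values of [q1] and [q2] coprime to [n] multiply to such a value of [q]; the residue of this one
   value decides membership in the genus. *)
have [x1 [x2 [_ xn]]] := coprime_value n0 prim1.
have [y1 [y2 [_ yn]]] := coprime_value n0 prim2.
have qpos : positive_form q.
  apply: (@positive_form_disc _ (mu ((rv2 1 0)^T *m rv2 1 0))).
    by rewrite D oppr_lt0 mulr_gt0.
  by rewrite -muE mulr_gt0 ?pos1 ?pos2 // rv2_neq0.
have [a [b [c [ac cl1]]]] := normal_form hsf hn4 disc1.
have [g _ gE] := class_sym cl1.
have R := lattice_pair_residue Lb Lp (etrans L1 (bqf_class_eq cl1)) L2.
apply: (@residue_GG n q (mu ((rv2 x1 x2)^T *m rv2 y1 y2))) => //.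
  by rewrite -muE coprimezMl xn.
(* In the normal form, [q1] is [a X ^ 2] modulo [n], so the residue of [- a q2] is multiplied by a
   square. *)
have [t [k tk]] := R (rv2 y1 y2).
rewrite -muE gE [rv2 x1 x2 *m g]rv2E bqf_rv2 /=.
move: (_ 0 0) (_ 0 1) => X Y; move: (q2 _) tk => z tk.
exists (t * X), (k * X ^+ 2 - (2 * b * X * Y + c * Y ^+ 2) * z).
by apply: (@lincomb _ _ _ _ _ _ _ _ (X ^+ 2) 0 0 tk tk tk); ring.
Qed.
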